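(* Let $\mathfrak{h}_1(s)=-\nu(s-1)\,e^{-\partial_s}-\nu(s)\,e^{\partial_s}+[2\sigma(s)+\tau(s)]I$ with $\nu(s)=\sqrt{\sigma(s+1)[\sigma(s)+\tau(s)]}$, and for $\alpha\in\mathbb{C}$ let $$\mathfrak{a}^{\downarrow}_\alpha(s)=e^{-\alpha\partial_s}\left(e^{\partial_s}\sqrt{\sigma(s)}-\sqrt{\sigma(s)+\tau(s)}\,I\right),\qquad \mathfrak{a}^{\uparrow}_\alpha(s)=\left(\sqrt{\sigma(s)}\,e^{-\partial_s}-\sqrt{\sigma(s)+\tau(s)}\,I\right)e^{\alpha\partial_s}.$$ Then for all $\alpha\in\mathbb{C}$, $$\mathfrak{h}_1(s)=\mathfrak{a}^{\uparrow}_\alpha(s)\,\mathfrak{a}^{\downarrow}_\alpha(s).$$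
   Context: Here $\sigma$ and $\tau$ are the coefficients of the hypergeometric-type difference equation on the uniform lattice, $\sigma(s)\Delta\nabla y(s)+\tau(s)\Delta y(s)+\lambda y(s)=0$, where $\Delta f(s)=f(s+1)-f(s)$ and $\nabla f(s)=f(s)-f(s-1)$; $\sigma$ is a polynomial of degree at most $2$ and $\tau$ a polynomial of degree at most $1$. The shift operator is $e^{\alpha\partial_s}f(s)=f(s+\alpha)$ for $\alpha\in\mathbb{C}$, and $I$ is the identity operator. A function of $s$ written in an operator expression denotes multiplication by that function, and products of operators denote composition (so $e^{\alpha\partial_s}f(s)=f(s+\alpha)e^{\alpha\partial_s}$ as operators). The identity is one between formal difference operators. Square roots are handled formally and consistently: $\sqrt{f}\,\sqrt{g}=\sqrt{fg}$, $\sqrt f\sqrt f=f$, and shifting $\sqrt{f(s)}$ by $\beta$ gives $\sqrt{f(s+\beta)}$. *)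

(* Defs.v *)
From HB Require Import structures.
From mathcomp Require Import all_boot all_order all_algebra.
From mathcomp Require Import all_classical all_reals.
From mathcomp Require Export complex.

Set Implicit Arguments.
Unset Strict Implicit.
Unset Printing Implicit Defensive.

Import Order.TTheory GRing.Theory Num.Theory.
Local Open Scope ring_scope.
Local Open Scope complex_scope.

(* Difference operators act on arbitrary functions C -> C. Testing on indicator
   functions of points shows that such an action determines the coefficients
   of a finite sum of terms f(s) e^{a d_s}, so equality of these maps is
   equality of formal difference operators. The sum and difference of
   operators are the pointwise ones of MathComp; the product of operators is
   composition, written \o (the ring product of MathComp is pointwise). *)
Definition fn (R : realType) := R[i] -> R[i].
Definition operator (R : realType) := (R[i] -> R[i]) -> (R[i] -> R[i]).

Definition shift_op (R : realType) (a : R[i]) : operator R :=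
  fun f s => f (s + a).

Definition mul_op (R : realType) (g : fn R) : operator R :=
  fun f s => g s * f s.

(* The expressions standing under a square root sign. Square roots are attached
   to expressions and not to functions: no map on functions satisfies
   sqrt f * sqrt g = sqrt (f * g) and sqrt f * sqrt f = f throughout, since
   f = g = -1 would give sqrt 1 = -1, and f = g = 1 gives sqrt 1 = 1. *)
Inductive radicand (R : realType) : Type :=
  | RadPoly of {poly R[i]}
  | RadShift of R[i] & radicand R
  | RadMul of radicand R & radicand R.

Fixpoint rad_value (R : realType) (r : radicand R) : fn R :=
  match r with
  | RadPoly p => fun s => p.[s]
  | RadShift b r => shift_op b (rad_value r)
  | RadMul r1 r2 => fun s => rad_value r1 s * rad_value r2 s
  end.

Definition formal_sqrt (R : realType) (sqrt : radicand R -> fn R) : Prop :=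
  [/\ forall r s, sqrt r s * sqrt r s = rad_value r s,
      forall r1 r2 s, sqrt (RadMul r1 r2) s = sqrt r1 s * sqrt r2 s
    & forall b r s, sqrt (RadShift b r) s = sqrt r (s + b)].

Lemma formal_sqrt_exists (R : realType) :
  exists sqrt : radicand R -> fn R, formal_sqrt sqrt.
Proof.
pose fix rt (r : radicand R) : fn R :=
  match r with
  | RadPoly p => fun s => sqrtC p.[s]
  | RadShift b r => shift_op b (rt r)
  | RadMul r1 r2 => fun s => rt r1 s * rt r2 s
  end.
exists rt; split=> //; elim=> [p|b r IH|r1 IH1 r2 IH2] s /=.
- by rewrite -expr2 sqrtCK.
- exact: IH.
- by rewrite mulrACA IH1 IH2.
Qed.

Section Operators.
Variables (R : realType) (sqrt : radicand R -> fn R) (sigma tau : {poly R[i]}).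

Definition nu : fn R :=
  sqrt (RadMul (RadShift 1 (RadPoly sigma)) (RadPoly (sigma + tau))).

Definition h1 : operator R :=
  - (mul_op (fun s => nu (s - 1)) \o shift_op (-1))
  - (mul_op nu \o shift_op 1)
  + mul_op (fun s => 2 * sigma.[s] + tau.[s]).

Definition a_down (a : R[i]) : operator R :=
  shift_op (- a) \o
    (shift_op 1 \o mul_op (sqrt (RadPoly sigma))
     - mul_op (sqrt (RadPoly (sigma + tau)))).

Definition a_up (a : R[i]) : operator R :=
  (mul_op (sqrt (RadPoly sigma)) \o shift_op (-1)
   - mul_op (sqrt (RadPoly (sigma + tau)))) \o shift_op a.

End Operators.

(* Main.v *)
Require Import Defs.
From mathcomp Require Import all_boot all_order all_algebra.
From mathcomp Require Import all_classical all_reals.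
From mathcomp Require Import ring.
Import GRing.Theory.
Local Open Scope ring_scope.
Local Open Scope complex_scope.

(** Write p and q for the square roots of sigma and sigma + tau. In the product
    of the two first-order operators the inner factors e^{a d_s} and
    e^{-a d_s} meet and cancel, and what is left is
    (p e^{-d_s} - q) (e^{d_s} p - q). Of its four terms, the two
    diagonal ones are the squares p^2 + q^2 = 2 sigma + tau, because
    e^{-d_s} e^{d_s} = I, and the two cross terms have coefficients
    - p(s) q(s - 1) and - q(s) p(s + 1). These are - nu(s - 1) and - nu(s),
    since nu(s) = p(s + 1) q(s) by multiplicativity of the formal square root
    and its compatibility with shifts ([nuE]). *)

Lemma nuE {R : realType} {sqrt : radicand R -> fn R} (sigma tau : {poly R[i]})
    (s : R[i]) :
  formal_sqrt sqrt ->
  nu sqrt sigma tau s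
  = sqrt (RadPoly sigma) (s + 1) * sqrt (RadPoly (sigma + tau)) s.
Proof. by case=> _ sqrtM sqrt_shift; rewrite /nu sqrtM sqrt_shift. Qed.

Theorem theorem3p2 (R : realType) (sigma tau : {poly R[i]})
    (size_sigma : (size sigma <= 3)%N) (size_tau : (size tau <= 2)%N)
    (sqrt : radicand R -> fn R) (sqrtP : formal_sqrt sqrt) (a : R[i]) :
  h1 sqrt sigma tau = a_up sqrt sigma tau a \o a_down sqrt sigma tau a.
Proof.
have [sqrtK _ _] := sqrtP.
apply/funext => f; apply/funext => s.
set p := sqrt (RadPoly sigma); set q := sqrt (RadPoly (sigma + tau)).
have pp : p s * p s = sigma.[s] by rewrite sqrtK.
have qq : q s * q s = sigma.[s] + tau.[s] by rewrite sqrtK /= hornerD.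
transitivity (- (nu sqrt sigma tau (s - 1) * f (s - 1))
    - nu sqrt sigma tau s * f (s + 1)
    + (2 * sigma.[s] + tau.[s]) * f s); first by [].
transitivity (
    p s * (p (s - 1 + a - a + 1) * f (s - 1 + a - a + 1)
           - q (s - 1 + a - a) * f (s - 1 + a - a))
    - q s * (p (s + a - a + 1) * f (s + a - a + 1)
             - q (s + a - a) * f (s + a - a))); last by [].
rewrite !addrK !subrK !nuE // -/p -/q subrK.
have -> : 2 * sigma.[s] + tau.[s] = p s * p s + q s * q s.
  by rewrite pp qq; ring.
ring.
Qed.
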